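(* Let $a,b,n$ be positive integers with $2\leq b\leq a-2$ and $a\leq \frac{n}{2\ln n}$. Then every $n$-uniform hypergraph $H$ with $$|E(H)| \leq (ab^3)^{-1/2}\left(\frac{n}{\ln n}\right)^{1/2}\left(\frac{a}{b}\right)^{n-1}$$ is $(a:b)$-colorable.
   Context: A hypergraph is a pair $H=(V,E)$, where $V$ is the set of vertices and $E=E(H)$ is a family of subsets of $V$, called edges. It is $n$-uniform if every edge contains exactly $n$ vertices. An $(a:b)$-coloring of $H$ assigns to each vertex $v\in V$ a set of exactly $b$ distinct colors from $[a]=\{1,\ldots,a\}$, i.e. it is a map $\chi:V\to\binom{[a]}{b}$. An edge $A\in E$ is properly colored if no single color is shared by all vertices of $A$, i.e. $\bigcap_{v\in A}\chi(v)=\varnothing$. The hypergraph $H$ is $(a:b)$-colorable if there is such a map $\chi$ under which every edge is properly colored. Here $\ln$ is the natural logarithm. *)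

(* Defs.v *)
From mathcomp Require Import all_boot all_order all_algebra finmap.
From mathcomp Require Import reals exp.

Set Implicit Arguments.
Unset Strict Implicit.
Unset Printing Implicit Defensive.

(* The vertex set is a whole type V, possibly infinite.  Only hypergraphs with
   finitely many edges, all of them finite, are represented: every uniform
   hypergraph whose number of edges is bounded by a real number is of this
   kind. *)
Definition hypergraph (V : choiceType) := {fset {fset V}}.

Definition uniform (V : choiceType) (n : nat) (H : hypergraph V) : Prop :=
  forall A : {fset V}, A \in H -> #|` A| = n.

(* The color i + 1 of {1, ..., a} is represented by i : 'I_a. *)
Definition is_coloring (V : choiceType) (a b : nat) (chi : V -> {set 'I_a}) :
    Prop :=
  forall v : V, #|chi v| = b.

Definition properly_colored (V : choiceType) (a : nat)
    (chi : V -> {set 'I_a}) (A : {fset V}) : Prop :=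
  \bigcap_(v <- A) chi v = set0.

Definition colorable (V : choiceType) (a b : nat) (H : hypergraph V) : Prop :=
  exists chi : V -> {set 'I_a},
    is_coloring b chi /\
    forall A : {fset V}, A \in H -> properly_colored chi A.

(* Main.v *)
Require Import Defs.
From mathcomp Require Import all_boot all_order all_algebra perm finmap.
From mathcomp Require Import reals sequences exp ring lra zify.

(** The coloring is found by the probabilistic method, as a random coloring
    followed by one round of swaps.

    Every vertex independently gets a random bijection from the [a] colors to
    the positions [0, ..., a - 1] and a random time in [0, ..., N - 1].  Its
    initial colors are those at positions below [b].  The only change it can
    make is to swap the color at position [0] for the color at position [b],
    and it may do so only if its time is below a threshold [K].  It does so
    when some edge containing it is initially monochromatic in the color at
    its position [0] and no vertex of that edge with this color at position
    [0] has a smaller time.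

    If the final coloring is bad ([recoloring_proper]), then either
    - an edge is initially monochromatic in a color [c] and none of its vertices
      with [c] at position [0] has a time below [K], or
    - some edge [B] is finally monochromatic in a color [d], and the last vertex
      [v] of [B] to acquire [d] did so, at time [t], because of an edge [A]
      initially monochromatic in a color [c].

    With [p = K / N], an event of the first kind has probability
    [((b - p) / a) ^ n].  In the second kind, with [y = t / N], a vertex of [A]
    satisfies its constraint with probability [(b - y) / a] and a vertex of [B]
    with probability about [(b + y) / a], so that the dependence on [y] cancels
    to first order and each pair of vertices contributes about [(b / a) ^ 2]
    ([pr_swap_event]).  Since a color is given up only if it is at position [0]
    and acquired only if it is at position [b], the vertex [v] and its time
    cost only a factor [1 / (a (a - 1) N)].  A vertex common to [A] and [B]
    must hold both [c] and [d], which is less likely than [(b / a) ^ 2] by a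
    factor [r] with [1 - r] about [(a - b) / (a b)]; this compensates for the
    choice of [v] in the intersection ([mulrn_exp_le]).

    In total, with [e = |E| (b / a) ^ (n - 1)], the expected number of bad
    events is about [e b exp (- p n / b) + e ^ 2 p a b / (a - b)]
    ([colorable_of_weight]).  For [p] about [b ln n / n] and
    [e ^ 2 <= n / (a b ^ 3 ln n)] the first term is small and the second is
    about [1 / (b (a - b))], so that the sum is less than [1]
    ([static_weight_le], [swap_weight_le]). *)

Import Order.TTheory GRing.Theory Num.Theory.
Set Implicit Arguments.
Unset Strict Implicit.
Unset Printing Implicit Defensive.
Local Open Scope ring_scope.

(** * Uniform probability on a finite type *)

Section UniformProbability.
Variable R : realFieldType.

Definition pr (T : finType) (X : pred T) : R := #|X|%:R / #|T|%:R.

Lemma pr_ge0 (T : finType) (X : pred T) : 0 <= pr X.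
Proof. by rewrite divr_ge0. Qed.

Lemma pr_mono (T : finType) (X Y : pred T) :
  (forall t, X t -> Y t) -> pr X <= pr Y.
Proof.
move=> sXY; rewrite ler_wpM2r ?invr_ge0 // ler_nat.
by apply: subset_leq_card; apply/subsetP => t; apply: sXY.
Qed.

Lemma prE (T : finType) (X : pred T) :
  pr X = (\sum_t (X t)%:R) / #|T|%:R.
Proof.
congr (_ / _); rewrite -sum1_card natr_sum big_mkcond /=.
by apply: eq_bigr => t _; rewrite unfold_in; case: (X t).
Qed.

Lemma pr_or (T : finType) (X Y : pred T) :
  pr [pred t | X t || Y t] <= pr X + pr Y.
Proof.
rewrite !prE -mulrDl ler_wpM2r ?invr_ge0 // -big_split ler_sum //= => t _.
by case: (X t) (Y t) => [] [] /=; rewrite ?addr0 ?add0r ?lerDl.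
Qed.

(** The union bound.  Bad events are nested existential quantifiers, so that
    iterating it produces the corresponding nested sums. *)
Lemma pr_exists (T I : finType) (P : pred I) (X : I -> pred T) :
  pr [pred t | [exists i, P i && X i t]] <= \sum_(i | P i) pr (X i).
Proof.
rewrite prE; under [leRHS]eq_bigr do rewrite prE.
rewrite -mulr_suml exchange_big /= ler_wpM2r ?invr_ge0 // ler_sum // => t _.
case: existsP => [[i /andP [Pi Xi]]|_]; last by rewrite sumr_ge0.
by rewrite (bigD1 i) //= Xi lerDl sumr_ge0.
Qed.

Lemma pr_true (T : finType) (X : pred T) :
  (0 < #|T|)%N -> (forall t, X t) -> pr X = 1.
Proof.
move=> T_gt0 allX; rewrite /pr (eq_card (B := T)) => [|t].
  by rewrite divff // pnatr_eq0 -lt0n.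
by rewrite unfold_in allX.
Qed.

Lemma pr_lt1 (T : finType) (X : pred T) :
  (0 < #|T|)%N -> pr X < 1 -> exists t, ~~ X t.
Proof.
move=> T_gt0 ltX1; apply/existsP; rewrite -negb_forall.
by apply: contraTN ltX1 => /forallP allX; rewrite pr_true ?ltxx.
Qed.

(** The coordinates of a uniformly random function are independent, which is
    how product formulas enter the proof. *)
Lemma pr_family (V T : finType) (F : V -> pred T) :
  pr [pred f : {ffun V -> T} | [forall v, F v (f v)]] = \prod_v pr (F v).
Proof.
rewrite /pr prodf_div -natr_prod -natr_prod; congr (_%:R / _%:R).
  rewrite (eq_card (B := family F)) => [|f]; last by rewrite !unfold_in.
  by rewrite card_family /image_mem foldrE big_map big_enum.
by rewrite card_ffun prod_nat_const.
Qed.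

End UniformProbability.

Arguments pr R [T] X.

(** * Random permutations *)

Section Positions.
Variables (R : realFieldType) (a : nat).

(** A random permutation maps two distinct points to a uniformly random pair
    of distinct points.  Left translations make the left-hand side
    independent of the pair [(c, d)], and for each single permutation the sum
    over all such pairs is a reindexing of the double sum on the right. *)
Lemma sum_perm2 (h : 'I_a -> 'I_a -> R) (c d : 'I_a) : c != d ->
  \sum_(s : {perm 'I_a}) h (s c) (s d) =
  #|{perm 'I_a}|%:R / (a%:R * (a%:R - 1)) * \sum_i \sum_(j | j != i) h i j.
Proof.
move=> neq_cd.
have a_gt1 : (1 < a)%N.
  by have := max_card [set c; d]; rewrite cards2 neq_cd card_ord.
have transl c' d' : c' != d' ->
    \sum_(s : {perm 'I_a}) h (s c') (s d') = \sum_(s : {perm 'I_a}) h (s c) (s d).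
  move=> neq'; pose t : {perm 'I_a} := (tperm c c' * tperm (tperm c c' d) d')%g.
  have tc : t c = c'.
    have neq_td : tperm c c' d != c'.
      rewrite -[X in _ != X](tpermL c c') inj_eq 1?eq_sym //; exact: perm_inj.
    by rewrite permM tpermL (tpermD neq_td) // eq_sym.
  have td : t d = d' by rewrite permM tpermL.
  rewrite [RHS](reindex_inj (mulgI t)); apply: eq_bigr => s _.
  by rewrite !(permM t) tc td.
have inner (s : {perm 'I_a}) :
    \sum_i \sum_(j | j != i) h (s i) (s j) = \sum_i \sum_(j | j != i) h i j.
  rewrite [RHS](reindex_inj (@perm_inj _ s)); apply: eq_bigr => i _.
  rewrite [RHS](reindex_inj (@perm_inj _ s)); apply: eq_bigl => j.
  by rewrite (inj_eq perm_inj).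
have key : (\sum_(s : {perm 'I_a}) h (s c) (s d)) * (a%:R * (a%:R - 1)) =
    #|{perm 'I_a}|%:R * \sum_i \sum_(j | j != i) h i j.
  transitivity (\sum_(s : {perm 'I_a}) \sum_i \sum_(j | j != i) h (s i) (s j));
    last by rewrite (eq_bigr _ (fun s _ => inner s)) sumr_const mulr_natl.
  rewrite exchange_big /=; under [RHS]eq_bigr do rewrite exchange_big /=.
  under [RHS]eq_bigr => i _.
    under eq_bigr => j neq_ij do rewrite transl 1?eq_sym //.
    rewrite sumr_const (cardC1 i) card_ord.
    over.
  rewrite sumr_const card_ord -mulrnA -[RHS]mulr_natr.
  congr (_ * _); rewrite natrM mulrC -subn1 natrB //; exact: ltnW.
rewrite mulrAC -key mulfK // mulf_neq0 // ?subr_eq0 ?pnatr_eq0 ?(pnatr_eq1) -?lt0n; lia.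
Qed.
End Positions.

(** * Random labels *)

Lemma card_ord_lt (a b : nat) : (b <= a)%N -> #|[set i : 'I_a | (i < b)%N]| = b.
Proof.
move=> le_ba; rewrite cardsE -sum1_card.
by rewrite -(big_ord_widen a (fun=> 1%N) le_ba) sum_nat_const card_ord muln1.
Qed.

Section Sums.
Variable R : realFieldType.

Lemma sum_ord_lt (a b : nat) : (b <= a)%N ->
  \sum_(i < a) (i < b)%N%:R = b%:R :> R.
Proof.
move=> le_ba; rewrite -natr_sum; congr _%:R.
rewrite -[RHS](card_ord_lt le_ba) -sum1_card [RHS]big_mkcond.
by apply: eq_bigr => i _; rewrite inE; case: (i < b)%N.
Qed.

Lemma sum_ord_eq (a b : nat) : (b < a)%N ->
  \sum_(i < a) (i == b :> nat)%:R = 1 :> R.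
Proof.
move=> lt_ba; rewrite (bigD1 (Ordinal lt_ba)) //= eqxx big1 ?addr0 // => i.
by rewrite -val_eqE /= => /negPf ->.
Qed.

(** Sums over pairs of distinct positions reduce to separable sums. *)
Lemma sum_offdiag (I : finType) (h : I -> I -> R) :
  \sum_i \sum_(j | j != i) h i j = \sum_i (\sum_j h i j - h i i).
Proof. by apply: eq_bigr => i _; rewrite [in RHS](bigD1 i) //= addrAC subrr add0r. Qed.

End Sums.

(** The random data of one vertex: a bijection from colors to positions, and a
    time. *)
Local Notation label a N := ({perm 'I_a} * 'I_N)%type.

Section Labels.
Variables (R : realFieldType) (a b N : nat).

Implicit Type o : label a N.

(** What every vertex of an edge has to satisfy for a swap at time [t] to be
    due to the initial monochromaticity of that edge in the color [c]; for
    [t = K], it means that the edge is never repaired. *)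
Definition keeps_until (c : 'I_a) (t : nat) o :=
  (o.1 c < b)%N && ((o.1 c == 0%N :> nat) ==> (t <= o.2)%N).

(** What every vertex of an edge has to satisfy for that edge to be finally
    monochromatic in [d] with [t] the latest time at which [d] is acquired. *)
Definition gains_by (d : 'I_a) (t : nat) o :=
  (o.1 d < b)%N || ((o.1 d == b :> nat) && (o.2 <= t)%N).

Definition swaps_at (c d : 'I_a) (t : nat) o :=
  [&& o.1 c == 0%N :> nat, o.1 d == b :> nat & o.2 == t :> nat].

Hypotheses (b_gt0 : (0 < b)%N) (lt_ba : (b < a)%N) (N_gt0 : (0 < N)%N).

Let le_ba : (b <= a)%N. Proof. exact: ltnW. Qed.
Let a_neq0 : a%:R != 0 :> R. Proof. by rewrite pnatr_eq0; lia. Qed.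
Let a1_neq0 : a%:R - 1 != 0 :> R.
Proof. by rewrite subr_eq0 pnatr_eq1; lia. Qed.
Let N_neq0 : N%:R != 0 :> R. Proof. by rewrite pnatr_eq0; lia. Qed.

(** Every event about two fixed colors depends only on their two positions
    and on the time, so its probability is a count of triples. *)
Lemma pr_label2 (Q : 'I_a -> 'I_a -> 'I_N -> bool) (c d : 'I_a) : c != d ->
  pr R [pred o : label a N | Q (o.1 c) (o.1 d) o.2] =
  (\sum_i \sum_(j | j != i) \sum_w (Q i j w)%:R) / (a%:R * (a%:R - 1) * N%:R).
Proof.
move=> neq_cd; rewrite prE card_prod card_ord natrM.
rewrite -(pair_bigA _ (fun (s : {perm 'I_a}) w => (Q (s c) (s d) w)%:R)) /=.
rewrite (sum_perm2 (fun i j => \sum_w (Q i j w)%:R) neq_cd).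
have perm_neq0 : #|{perm 'I_a}|%:R != 0 :> R.
  by rewrite pnatr_eq0 -lt0n; apply/card_gt0P; exists 1%g.
by field; rewrite N_neq0 a1_neq0 a_neq0 perm_neq0.
Qed.

Lemma pr_label1 (Q : 'I_a -> 'I_N -> bool) (c : 'I_a) :
  pr R [pred o : label a N | Q (o.1 c) o.2] =
  (\sum_i \sum_w (Q i w)%:R) / (a%:R * N%:R).
Proof.
have [d neq_cd] : exists d : 'I_a, c != d.
  case: (pickP (predC1 c)) => [d /= ? | all_c]; first by exists d; rewrite eq_sym.
  have := cardC1 c; rewrite (eq_card0 all_c) card_ord; lia.
rewrite (pr_label2 (fun i _ => Q i) neq_cd).
have a1E : a.-1%:R = a%:R - 1 :> R by rewrite -subn1 natrB //; lia.
under eq_bigr do rewrite sumr_const (cardC1 _) card_ord -[_ *+ _]mulr_natr a1E.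
rewrite -mulr_suml.
by field; rewrite N_neq0 a1_neq0 a_neq0.
Qed.

Lemma pr_keeps_until (c : 'I_a) (t : nat) : (t <= N)%N ->
  pr R (keeps_until c t) = (b%:R - t%:R / N%:R) / a%:R.
Proof.
move=> le_tN.
rewrite (pr_label1 (fun i w => (i < b)%N && ((i == 0%N :> nat) ==> (t <= w)%N))).
have ind (i : 'I_a) (w : 'I_N) :
    ((i < b)%N && ((i == 0%N :> nat) ==> (t <= w)%N))%:R
    = (i < b)%N%:R - (i == 0%N :> nat)%:R * (w < t)%N%:R :> R.
  have [->|_] := eqVneq (i : nat) 0%N; last by rewrite andbT mul0r subr0.
  by rewrite b_gt0 /= mul1r ltnNge; case: (t <= w)%N; rewrite ?subr0 ?subrr.
under eq_bigr => i _.
  under eq_bigr do rewrite ind.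
  rewrite sumrB sumr_const card_ord -mulr_sumr sum_ord_lt // -[_ *+ _]mulr_natr.
  over.
rewrite sumrB -!mulr_suml (sum_ord_lt _ le_ba) sum_ord_eq; last lia.
by field; rewrite N_neq0 a_neq0.
Qed.

Lemma pr_gains_by (d : 'I_a) (t : nat) : (t < N)%N ->
  pr R (gains_by d t) = (b%:R + t.+1%:R / N%:R) / a%:R.
Proof.
move=> lt_tN.
rewrite (pr_label1 (fun i w => (i < b)%N || ((i == b :> nat) && (w <= t)%N))).
have ind (i : 'I_a) (w : 'I_N) :
    ((i < b)%N || ((i == b :> nat) && (w <= t)%N))%:R
    = (i < b)%N%:R + (i == b :> nat)%:R * (w < t.+1)%N%:R :> R.
  rewrite ltnS; have [->|_] := eqVneq (i : nat) b; last by rewrite orbF mul0r addr0.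
  by rewrite ltnn /= mul1r add0r.
under eq_bigr => i _.
  under eq_bigr do rewrite ind.
  rewrite big_split sumr_const card_ord /= -mulr_sumr sum_ord_lt // -[_ *+ _]mulr_natr.
  over.
rewrite big_split /= -!mulr_suml (sum_ord_lt _ le_ba) sum_ord_eq; last lia.
by field; rewrite N_neq0 a_neq0.
Qed.

(** The time [t] cancels out.  Compared with the product of the two separate
    probabilities, about [(b / a) ^ 2], there is an extra factor
    of about [a (b - 1) / (b (a - 1)) < 1], since [c] and [d] compete for positions;
    this is what makes edges with a large intersection harmless. *)
Lemma pr_keeps_gains (c d : 'I_a) (t : nat) : c != d -> (t < N)%N ->
  pr R [pred o | keeps_until c t o && gains_by d t o]
  = b%:R * (b%:R - 1 + N%:R^-1) / (a%:R * (a%:R - 1)).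
Proof.
move=> neq_cd lt_tN.
rewrite (pr_label2 (fun i j w => ((i < b)%N && ((i == 0%N :> nat) ==> (t <= w)%N)
      && ((j < b)%N || ((j == b :> nat) && (w <= t)%N)))) neq_cd).
(* Inclusion-exclusion, with every term a product of a condition on [i], one
   on [j] and one on [w]. *)
have ind (i j : 'I_a) (w : 'I_N) :
    ((i < b)%N && ((i == 0%N :> nat) ==> (t <= w)%N)
      && ((j < b)%N || ((j == b :> nat) && (w <= t)%N)))%:R
    = (i < b)%N%:R * (j < b)%N%:R
      + (i < b)%N%:R * (j == b :> nat)%:R * (w < t.+1)%N%:R
      - (i == 0%N :> nat)%:R * ((j < b)%N%:R + (j == b :> nat)%:R)
        * (w < t)%N%:R :> R.
  rewrite ltnS [(w < t)%N]ltnNge; have [->|_] := eqVneq (i : nat) 0%N.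
    rewrite b_gt0 /=.
    by case: (ltngtP j b) => _; case: (ltngtP t w) => _ /=; ring.
  by case: (i < b)%N; case: (ltngtP j b) => _; case: (w <= t)%N => /=; ring.
pose h (i j : 'I_a) : R := (i < b)%N%:R * (j < b)%N%:R * N%:R
  + (i < b)%N%:R * (j == b :> nat)%:R * t.+1%:R
  - (i == 0%N :> nat)%:R * ((j < b)%N%:R + (j == b :> nat)%:R) * t%:R.
have sum_w (i j : 'I_a) : \sum_(w < N) ((i < b)%N && ((i == 0%N :> nat) ==> (t <= w)%N)
      && ((j < b)%N || ((j == b :> nat) && (w <= t)%N)))%:R = h i j.
  under eq_bigr do rewrite ind.
  rewrite sumrB big_split sumr_const card_ord /= -!mulr_sumr.
  by rewrite (sum_ord_lt _ lt_tN) (sum_ord_lt _ (ltnW lt_tN)) -[_ *+ _]mulr_natr.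
under eq_bigr do under eq_bigr do rewrite sum_w.
rewrite sum_offdiag.
have sum_j (i : 'I_a) : \sum_j h i j - h i i = (i < b)%N%:R * (b%:R * N%:R + t.+1%:R - N%:R)
    - (i == 0%N :> nat)%:R * ((b%:R + 1) * t%:R - t%:R).
  rewrite /h sumrB big_split /= -!mulr_suml -!mulr_sumr big_split /=.
  rewrite (sum_ord_lt _ le_ba) sum_ord_eq //.
  have [lt_ib|le_bi] := ltnP i b.
    rewrite (ltn_eqF lt_ib).
    by case: (i == 0%N :> nat) => /=; ring.
  rewrite (_ : (i == 0%N :> nat) = false) /=; last by lia.
  by ring.
rewrite (eq_bigr _ (fun i _ => sum_j i)) sumrB -!mulr_suml.
rewrite (sum_ord_lt _ le_ba) sum_ord_eq; last lia.
by field; rewrite N_neq0 a1_neq0 a_neq0.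
Qed.

Lemma pr_swaps_at (c d : 'I_a) (t : nat) : c != d -> (t < N)%N ->
  pr R (swaps_at c d t) = (a%:R * (a%:R - 1) * N%:R)^-1.
Proof.
move=> neq_cd lt_tN.
rewrite (pr_label2 (fun i j w => [&& i == 0%N :> nat, j == b :> nat & w == t :> nat]) neq_cd).
have ind (i j : 'I_a) (w : 'I_N) :
    [&& i == 0%N :> nat, j == b :> nat & w == t :> nat]%:R
    = (i == 0%N :> nat)%:R * (j == b :> nat)%:R * (w == t :> nat)%:R :> R.
  by rewrite -!natrM !mulnb andbA.
have sum_w (i j : 'I_a) : \sum_(w < N) [&& i == 0%N :> nat, j == b :> nat & w == t :> nat]%:R
    = (i == 0%N :> nat)%:R * (j == b :> nat)%:R :> R.
  by under eq_bigr do rewrite ind; rewrite -mulr_sumr sum_ord_eq // mulr1.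
under eq_bigr do under eq_bigr do rewrite sum_w.
rewrite sum_offdiag.
have sum_j (i : 'I_a) : \sum_(j < a) (i == 0%N :> nat)%:R * (j == b :> nat)%:R
    - (i == 0%N :> nat)%:R * (i == b :> nat)%:R = (i == 0%N :> nat)%:R :> R.
  rewrite -mulr_sumr sum_ord_eq // mulr1.
  have [->|_] := eqVneq (i : nat) 0%N; last by rewrite mul0r subr0.
  by rewrite eq_sym (gtn_eqF b_gt0) mulr0 subr0.
rewrite (eq_bigr _ (fun i _ => sum_j i)) sum_ord_eq; last lia.
by rewrite mul1r.
Qed.
End Labels.

(** * Recoloring *)

Lemma card_perm_preim (a : nat) (s : {perm 'I_a}) (P : pred 'I_a) :
  #|[set c | P (s c)]| = #|[set i | P i]|.
Proof.
rewrite -(card_preimset [set i | P i] (@perm_inj _ s)).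
by apply: eq_card => c; rewrite !inE.
Qed.

Section Recoloring.
Variables (a b N K : nat) (T : finType) (E : {set {set T}}).
Variable f : T -> label a N.
Hypotheses (b_gt0 : (0 < b)%N) (lt_ba : (b < a)%N).

(** A vertex swaps when it is among the earliest vertices able to destroy the
    monochromaticity, in the color at its position [0], of some edge.  The
    condition refers to initial colors and times only, so swaps do not
    interact; ties are allowed, all the earliest vertices then swap. *)
Definition recolored (v : T) :=
  [exists A in E, exists c, [&& v \in A, (f v).1 c == 0%N :> nat,
     ((f v).2 < K)%N & [forall u in A, keeps_until b c (f v).2 (f u)]]].

(** Swapping slides the window of positions from [[0, b - 1]] to [[1, b]]. *)
Definition recoloring (v : T) : {set 'I_a} :=
  if recolored v then [set c | (0 < (f v).1 c <= b)%N]
  else [set c | ((f v).1 c < b)%N].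

Lemma card_recoloring v : #|recoloring v| = b.
Proof.
rewrite /recoloring; case: recolored.
  rewrite (card_perm_preim _ (fun i : 'I_a => 0 < i <= b)%N).
  have a_gt0 : (0 < a)%N by lia.
  have := cardsD1 (Ordinal a_gt0) [set i : 'I_a | (i < b.+1)%N].
  rewrite (card_ord_lt lt_ba) inE /= add1n => -[{2}->].
  apply: eq_card => i; rewrite !inE -val_eqE /=; lia.
by rewrite (card_perm_preim _ (fun i : 'I_a => i < b)%N) (card_ord_lt (ltnW lt_ba)).
Qed.

(** Suppose that a color [d] survives on all of [B].  If some vertex of [B]
    acquired [d], the latest one to do so, [v], swapped because of an edge [A]
    monochromatic in another color [c], and [A], [B], [c], [d], [v] and the
    time of [v] contradict the second hypothesis.  Otherwise [B] was
    monochromatic in [d] from the start; by the first hypothesis some vertex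
    of [B] could give [d] up, and the earliest such vertex did. *)
Lemma recoloring_proper :
  (forall A c, A \in E -> ~~ [forall u in A, keeps_until b c K (f u)]) ->
  (forall A B c d v (t : 'I_K), A \in E -> B \in E -> c != d ->
    v \in A -> v \in B -> swaps_at b c d t (f v) ->
    ~~ ([forall u in A, keeps_until b c t (f u)] &&
        [forall u in B, gains_by b d t (f u)])) ->
  forall B d, B \in E -> exists2 u, u \in B & d \notin recoloring u.
Proof.
move=> no_static no_swap B d BE.
case: (boolP [exists u in B, d \notin recoloring u]) => [/existsP[u /andP[]]|];
  first by exists u.
rewrite negb_exists => /forallP allB.
have {}allB u : u \in B -> d \in recoloring u.
  by move=> uB; have := allB u; rewrite uB /= negbK.
case: (boolP [exists v in B, recolored v && ((f v).1 d == b :> nat)]).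
  move=> /existsP[v0 Pv0].
  pose P v := [&& v \in B, recolored v & (f v).1 d == b :> nat].
  case: (@arg_maxnP _ v0 P (fun v => nat_of_ord (f v).2) Pv0) => v /and3P[vB rv dv] vmax.
  have /existsP[A /andP[AE /existsP[c /and4P[vA cv tv keepA]]]] := rv.
  have neq_cd : c != d.
    by apply: contraTneq dv => <-; rewrite (eqP cv) eq_sym -lt0n.
  have := no_swap A B c d v (Ordinal tv) AE BE neq_cd vA vB.
  rewrite /swaps_at cv dv eqxx keepA /= => /(_ isT) /negP[].
  apply/forallP => u; apply/implyP => uB; rewrite /gains_by.
  have := allB u uB; rewrite /recoloring; case: ifP => ru; rewrite inE; last by move->.
  case/andP=> _; rewrite leq_eqVlt => /orP[du|->//].
  by rewrite du; apply/orP; right; apply: vmax; rewrite /P uB ru du.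
rewrite negb_exists => /forallP noswap.
have early u : u \in B -> ((f u).1 d < b)%N.
  move=> uB; have := allB u uB; have := noswap u; rewrite uB /recoloring /=.
  by case: ifP => /= _; rewrite inE // => db /andP[_]; rewrite leq_eqVlt (negPf db).
have /forallPn[u0] := no_static B d BE.
rewrite negb_imply /keeps_until => /andP[u0B]; rewrite early //= negb_imply -ltnNge.
move=> lost0.
pose P v := [&& v \in B, (f v).1 d == 0%N :> nat & ((f v).2 < K)%N].
have P0 : P u0 by rewrite /P u0B.
case: (@arg_minnP _ u0 P (fun v => nat_of_ord (f v).2) P0) => v /and3P[vB dv tv] vmin.
have rv : recolored v.
  apply/existsP; exists B; rewrite BE /=; apply/existsP; exists d.
  rewrite vB dv tv /=; apply/forallP => u; apply/implyP => uB.
  rewrite /keeps_until early //=; apply/implyP => du.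
  have [le_Ku|lt_uK] := leqP K (f u).2; first exact: leq_trans (ltnW tv) le_Ku.
  by apply: vmin; rewrite /P uB du.
by have := allB v vB; rewrite /recoloring rv inE (eqP dv).
Qed.

End Recoloring.

(** * Union bound over the bad events *)

(** Each of the [k] vertices common to two edges may be the one that swaps;
    the factor [k] is absorbed since [k r ^ (k - 1)] is at most the sum of the
    geometric progression. *)
Lemma mulrn_exp_le (R : realFieldType) (r : R) (k : nat) :
  0 <= r < 1 -> k%:R * r ^+ k.-1 <= (1 - r)^-1.
Proof.
move=> /andP[r_ge0 r_lt1]; have r1_gt0 : 0 < 1 - r by rewrite subr_gt0.
have geom : (\sum_(i < k) r ^+ i) * (1 - r) = 1 - r ^+ k.
  by rewrite -[1 - r ^+ k]opprB subrX1 -mulNr opprB mulrC.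
rewrite -[leRHS]mul1r ler_pdivlMr //.
apply: (le_trans (y := (\sum_(i < k) r ^+ i) * (1 - r))); last first.
  by rewrite geom gerBl exprn_ge0.
rewrite ler_pM2r // -[k in leLHS]card_ord mulr_natl -sumr_const ler_sum // => i _.
apply: ler_wiXn2l => //; [exact: ltW | rewrite card_ord; have := ltn_ord i; lia].
Qed.

Lemma ler_sum_card (R : realFieldType) (I : finType) (P : pred I) (h : I -> R)
    (z : R) (m : nat) :
  #|P| = m -> (forall i, P i -> h i <= z) -> \sum_(i | P i) h i <= z * m%:R.
Proof. by move=> <- hz; rewrite mulr_natr -sumr_const; apply: ler_sum. Qed.

Section Estimate.
Variables (R : realFieldType) (a b n N : nat) (T : finType).
Hypotheses (b_gt0 : (0 < b)%N) (lt_ba : (b < a)%N) (N_gt0 : (0 < N)%N).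

Let a_gt1 : 1 < a%:R :> R. Proof. by rewrite ltr1n; lia. Qed.
Let a_gt0 : 0 < a%:R :> R. Proof. exact: lt_trans ltr01 a_gt1. Qed.
Let a1_gt0 : 0 < a%:R - 1 :> R. Proof. by rewrite subr_gt0. Qed.
Let b_gt0R : 0 < b%:R :> R. Proof. by rewrite ltr0n. Qed.
Let b_ge1R : 1 <= b%:R :> R. Proof. by rewrite ler1n. Qed.
Let N_gt0R : 0 < N%:R :> R. Proof. by rewrite ltr0n. Qed.

(** A bound, uniform in the time, for the product of the probabilities of
    [keeps_until] and [gains_by]: with [y = t / N], this product is
    [(b - y) (b + y + 1 / N) / a ^ 2], and the two shifts by [y] cancel to
    first order. *)
Definition edge_pair_weight : R := (b%:R / a%:R) ^+ 2 * (1 + (b%:R * N%:R)^-1).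

(** The probability of [keeps_until] and [gains_by] together, divided by
    [(b / a) ^ 2]. *)
Definition overlap_ratio : R :=
  a%:R * (b%:R - 1 + N%:R^-1) / (b%:R * (a%:R - 1)).

Let Q := edge_pair_weight.
Let r := overlap_ratio.

Let Q_ge0 : 0 <= Q.
Proof.
rewrite mulr_ge0 ?sqr_ge0 // addr_ge0 // invr_ge0 mulr_ge0 //; exact: ltW.
Qed.

Let r_ge0 : 0 <= r.
Proof.
rewrite divr_ge0 // mulr_ge0 ?(ltW a_gt0) ?(ltW b_gt0R) ?(ltW a1_gt0) //.
by rewrite addr_ge0 ?invr_ge0 ?(ltW N_gt0R) // subr_ge0.
Qed.

Definition swap_event (A B : {set T}) (c d : 'I_a) (v : T) (t : nat)
    (f : {ffun T -> label a N}) :=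
  [&& swaps_at b c d t (f v), [forall u in A, keeps_until b c t (f u)]
    & [forall u in B, gains_by b d t (f u)]].

(** Vertices are independent.  Outside [v], a vertex of both edges contributes
    at most [r * Q], and the vertices in exactly one edge, which are equally
    many in [A] and in [B], contribute at most [Q] per pair. *)
Lemma pr_swap_event (A B : {set T}) (c d : 'I_a) (v : T) (t : nat) :
  #|A| = n -> #|B| = n -> c != d -> v \in A -> v \in B -> (t < N)%N ->
  pr R (swap_event A B c d v t)
  <= (a%:R * (a%:R - 1) * N%:R)^-1 * r ^+ #|A :&: B|.-1 * Q ^+ n.-1.
Proof.
move=> cardA cardB neq_cd vA vB lt_tN.
pose alpha := pr R (keeps_until (N := N) b c t).
pose beta := pr R (gains_by (N := N) b d t).
pose gamma := pr R [pred o : label a N | keeps_until b c t o && gains_by b d t o].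
pose nu := pr R (swaps_at (N := N) b c d t).
pose F u (o : label a N) := [&& (u == v) ==> swaps_at b c d t o,
  (u \in A) ==> keeps_until b c t o & (u \in B) ==> gains_by b d t o].
have le_F : pr R (swap_event A B c d v t) <=
    pr R [pred f : {ffun T -> label a N} | [forall u, F u (f u)]].
  apply: pr_mono => f /and3P[sv /forallP kA /forallP gB].
  apply/forallP => u; rewrite /F kA gB !andbT.
  by apply/implyP => /eqP ->.
apply: le_trans le_F _; rewrite pr_family.
pose g u := if u == v then nu else if u \in A :&: B then gamma
  else (if u \in A then alpha else 1) * (if u \in B then beta else 1).
have le_g : \prod_u pr R (F u) <= \prod_u g u.
  apply: ler_prod => u _; rewrite pr_ge0 /= /g.
  have [->|/negPf nuv] := eqVneq u v; first by apply: pr_mono => o /and3P[]; rewrite eqxx.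
  rewrite inE; case: ifP => [/andP[uA uB]|].
    by apply: pr_mono => o /and3P[_]; rewrite uA uB /= => -> ->.
  case: ifP => uA; case: ifP => uB // _; rewrite ?mulr1 ?mul1r.
  - by apply: pr_mono => o /and3P[_]; rewrite uA.
  - by apply: pr_mono => o /and3P[_ _]; rewrite uB.
  rewrite pr_true // => [|o]; last by rewrite /F nuv uA uB.
  by apply/card_gt0P; exists (1%g, Ordinal lt_tN).
apply: le_trans le_g _.
have vAB : v \in A :&: B by rewrite inE vA.
set k := #|A :&: B|.
have k_gt0 : (0 < k)%N by apply/card_gt0P; exists v.
have le_kn : (k <= n)%N by rewrite -cardA subset_leq_card // subsetIl.
have n1E : n.-1 = (k.-1 + (n - k))%N.
  by rewrite addnC -[k.-1]subn1 addnBA // subnK // subn1.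
have prod_g : \prod_u g u = nu * (gamma ^+ k.-1 * (alpha * beta) ^+ (n - k)).
  rewrite (bigD1 v) //= {1}/g eqxx; congr (_ * _).
  rewrite (bigID [in A :&: B]) /=; congr (_ * _).
    rewrite (eq_bigr (fun=> gamma)) => [|u /andP[/negPf nuv uAB]]; last first.
      by rewrite /g nuv uAB.
    rewrite (eq_bigl [in (A :&: B) :\ v]) => [|u]; last by rewrite !inE.
    by rewrite prodr_const /k (cardsD1 v (A :&: B)) vAB.
  rewrite (eq_bigr (fun u => (if u \in A then alpha else 1) *
      (if u \in B then beta else 1))) => [|u /andP[/negPf nuv /negPf uAB]]; last first.
    by rewrite /g nuv uAB.
  rewrite big_split /= -!big_mkcondr /= exprMn; congr (_ * _).
    rewrite (eq_bigl [in A :\: B]) => [|u]; last first.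
      rewrite !inE; have [->|_] := eqVneq u v; first by rewrite vB.
      by case: (u \in A); case: (u \in B).
    by rewrite prodr_const cardsD cardA.
  rewrite (eq_bigl [in B :\: A]) => [|u]; last first.
    rewrite !inE; have [->|_] := eqVneq u v; first by rewrite vA.
    by case: (u \in A); case: (u \in B).
  by rewrite prodr_const cardsD cardB setIC.
rewrite prod_g -mulrA.
have -> : nu = (a%:R * (a%:R - 1) * N%:R)^-1 by exact: pr_swaps_at.
rewrite ler_wpM2l //.
  by rewrite invr_ge0 !mulr_ge0 // ltW.
have gammaE : gamma = (b%:R / a%:R) ^+ 2 * r.
  rewrite /gamma pr_keeps_gains // /r /overlap_ratio.
  by field; rewrite !gt_eqF.
have gamma_le : gamma <= r * Q.
  rewrite gammaE mulrC ler_wpM2l // ler_peMr ?sqr_ge0 //.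
  by rewrite lerDl invr_ge0 mulr_ge0 // ltW.
have alpha_beta : alpha * beta <= Q.
  rewrite /alpha /beta pr_keeps_until ?pr_gains_by // 1?ltnW //.
  set y := t%:R / N%:R.
  have y_ge0 : 0 <= y by rewrite divr_ge0.
  have -> : t.+1%:R / N%:R = y + N%:R^-1 by rewrite -natr1 mulrDl mul1r.
  have -> : Q = (b%:R * (b%:R + N%:R^-1)) / a%:R ^+ 2.
    by rewrite /Q /edge_pair_weight; field; rewrite !gt_eqF.
  rewrite mulf_div -expr2 ler_wpM2r ?invr_ge0 ?exprn_ge0 //.
  have := mulr_ge0 y_ge0 y_ge0.
  have : 0 <= y * N%:R^-1 by rewrite mulr_ge0 ?invr_ge0.
  by nra.
have gamma_ge0 : 0 <= gamma by exact: pr_ge0.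
have ab_ge0 : 0 <= alpha * beta by rewrite mulr_ge0 ?pr_ge0.
rewrite n1E [Q ^+ _]exprD [leRHS]mulrA -[r ^+ _ * _]exprMn.
apply: ler_pM; rewrite ?exprn_ge0 //; apply: lerXn2r; rewrite ?nnegrE //.
exact: mulr_ge0.
Qed.

Definition static_event (K : nat) (A : {set T}) (c : 'I_a)
    (f : {ffun T -> label a N}) := [forall u in A, keeps_until b c K (f u)].

Lemma pr_static_event (K : nat) (A : {set T}) (c : 'I_a) :
  #|A| = n -> (K <= N)%N ->
  pr R (static_event K A c) = ((b%:R - K%:R / N%:R) / a%:R) ^+ n.
Proof.
move=> cardA le_KN.
rewrite (pr_family R (fun u o => (u \in A) ==> keeps_until b c K o)).
rewrite -cardA -prodr_const [RHS]big_mkcond /=; apply: eq_bigr => u _.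
case: (u \in A) => /=; first exact: pr_keeps_until.
rewrite pr_true //.
by apply/card_gt0P; exists (1%g, Ordinal N_gt0).
Qed.

(** The last hypothesis says that the union bound over the two kinds of bad
    events is less than [1].  In its second summand the number
    [a (a - 1) K] of choices of two colors and a time cancels against the
    probability that [v] has these parameters, leaving [K / N]; the last
    factor is [1 / (1 - r)] and accounts for the choice of [v]. *)
Lemma colorable_of_weight (K : nat) (E : {set {set T}}) :
  (forall A, A \in E -> #|A| = n) -> (K <= N)%N ->
  0 < a%:R - b%:R - a%:R / N%:R :> R ->
  #|E|%:R * a%:R * ((b%:R - K%:R / N%:R) / a%:R) ^+ n
  + #|E|%:R ^+ 2 * (K%:R / N%:R) * Q ^+ n.-1
    * (b%:R * (a%:R - 1) / (a%:R - b%:R - a%:R / N%:R)) < 1 ->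
  exists chi : T -> {set 'I_a}, (forall v, #|chi v| = b) /\
    forall B d, B \in E -> exists2 u, u \in B & d \notin chi u.
Proof.
move=> unifE le_KN; set gap := a%:R - b%:R - a%:R / N%:R => gap_gt0 lt1.
have r1E : 1 - r = gap / (b%:R * (a%:R - 1)).
  by rewrite /gap /r /overlap_ratio; field; rewrite !gt_eqF.
have r_lt1 : r < 1 by rewrite -subr_gt0 r1E divr_gt0 // mulr_gt0.
pose bad1 (f : {ffun T -> label a N}) :=
  [exists A, (A \in E) && [exists c, true && static_event K A c f]].
pose bad2 (f : {ffun T -> label a N}) :=
  [exists A, (A \in E) && [exists B, (B \in E) && [exists c, true &&
   [exists d, (d != c) && [exists v, (v \in A :&: B) &&
   [exists t : 'I_K, true && swap_event A B c d v t f]]]]]].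
have pr_bad1 : pr R bad1 <= #|E|%:R * a%:R * ((b%:R - K%:R / N%:R) / a%:R) ^+ n.
  apply: le_trans (pr_exists _ _ _) _.
  rewrite mulrC mulrA mulrAC; apply: ler_sum_card => [|A AE].
    exact: eq_card.
  apply: le_trans (pr_exists _ _ _) _.
  apply: ler_sum_card => [|c _]; first exact: card_ord.
  by rewrite pr_static_event ?unifE.
have pr_bad2 : pr R bad2 <= #|E|%:R ^+ 2 * (K%:R / N%:R) * Q ^+ n.-1
    * (b%:R * (a%:R - 1) / gap).
  pose w : R := (a%:R * (a%:R - 1) * N%:R)^-1 * Q ^+ n.-1 / (1 - r).
  have -> : #|E|%:R ^+ 2 * (K%:R / N%:R) * Q ^+ n.-1
    * (b%:R * (a%:R - 1) / gap)
    = w * K%:R * a.-1%:R * a%:R * #|E|%:R * #|E|%:R.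
    have -> : a.-1%:R = a%:R - 1 :> R by rewrite -subn1 natrB // (ltn_trans b_gt0).
    rewrite /w r1E; field.
    by rewrite !gt_eqF.
  apply: le_trans (pr_exists _ _ _) _; apply: ler_sum_card => [|A AE].
    exact: eq_card.
  apply: le_trans (pr_exists _ _ _) _; apply: ler_sum_card => [|B BE].
    exact: eq_card.
  apply: le_trans (pr_exists _ _ _) _; apply: ler_sum_card => [|c _].
    exact: card_ord.
  apply: le_trans (pr_exists _ _ _) _; apply: ler_sum_card => [|d neq_dc].
    by rewrite (cardC1 c) card_ord.
  apply: le_trans (pr_exists _ _ _) _.
  pose w' : R := (a%:R * (a%:R - 1) * N%:R)^-1 * r ^+ #|A :&: B|.-1 * Q ^+ n.-1.
  apply: (@le_trans _ _ (w' * K%:R * #|A :&: B|%:R)).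
    apply: ler_sum_card => [|v]; first exact: eq_card.
    rewrite inE => /andP[vA vB].
    apply: le_trans (pr_exists _ _ _) _; apply: ler_sum_card => [|t _].
      exact: card_ord.
    apply: pr_swap_event; rewrite ?unifE //; first by rewrite eq_sym.
    exact: leq_trans (ltn_ord t) le_KN.
  have r01 : 0 <= r < 1 by rewrite r_ge0.
  have -> : w' * K%:R * #|A :&: B|%:R = (a%:R * (a%:R - 1) * N%:R)^-1 * Q ^+ n.-1
      * (#|A :&: B|%:R * r ^+ #|A :&: B|.-1) * K%:R by rewrite /w'; ring.
  rewrite ler_wpM2r // ler_wpM2l ?mulrn_exp_le // mulr_ge0 ?exprn_ge0 //.
  by rewrite invr_ge0 !mulr_ge0 // ltW.
have [f] : exists f, ~~ (bad1 f || bad2 f).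
  apply: (@pr_lt1 R _ [pred f | bad1 f || bad2 f]).
    by apply/card_gt0P; exists [ffun=> (1%g, Ordinal N_gt0)].
  by apply: le_lt_trans lt1; apply: le_trans (pr_or _ _ _) _; apply: lerD.
rewrite negb_or => /andP[nbad1 nbad2].
exists (recoloring b K E f); split; first exact: card_recoloring.
apply: recoloring_proper => //.
  move=> A c AE; apply: contra nbad1 => stat.
  by apply/existsP; exists A; rewrite AE; apply/existsP; exists c.
move=> A B c d v t AE BE neq_cd vA vB sw; apply: contra nbad2 => kg.
apply/existsP; exists A; rewrite AE; apply/existsP; exists B; rewrite BE.
apply/existsP; exists c; apply/existsP; exists d; rewrite eq_sym neq_cd.
apply/existsP; exists v; rewrite inE vA vB; apply/existsP; exists t.
by rewrite /swap_event sw.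
Qed.

End Estimate.

(** * Numerical estimates *)

Lemma exp1D_le (R : realType) (x : R) (k : nat) : 0 <= 1 + x -> (1 + x) ^+ k <= expR (k%:R * x).
Proof.
move=> x_ge; rewrite expRM_natl lerXn2r ?nnegrE ?expR_ge0 //; exact: expR_ge1Dx.
Qed.

(** The time scale [N = 4 n] is fine enough for its discretization to cost
    only bounded factors.  The threshold [K] makes [K / N] just above
    [b ln n / n], so that an edge has no vertex able to destroy a given
    initial monochromaticity with conditional probability at most [1 / n]. *)

Section Numerics.
Variables (R : realType) (a b n : nat) (m : R).
Let L : R := ln n%:R.
Let N := (4 * n)%N.
Let K := (Num.truncn (4 * b%:R * L)).+1.
Hypotheses (b_ge2 : (2 <= b)%N) (le_ba : (b + 2 <= a)%N) (n_gt0 : (0 < n)%N).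
Hypothesis le_an : a%:R <= n%:R / (2 * L).
Hypothesis m_ge0 : 0 <= m.
Hypothesis le_m :
  (m * (b%:R / a%:R) ^+ n.-1) ^+ 2 <= n%:R / (a%:R * b%:R ^+ 3 * L).

Let aR : b%:R + 2 <= a%:R :> R. Proof. by rewrite -natrD ler_nat. Qed.
Let bR : 2 <= b%:R :> R. Proof. by rewrite ler_nat. Qed.

Let n_gt1 : (1 < n)%N.
Proof.
(* For [n = 1] the upper bound on [a] is [1 / 0], which is [0]. *)
rewrite ltn_neqAle n_gt0 andbT; apply/eqP => n1; move: le_an.
rewrite /L -n1 ln1 mulr0 invr0 mulr0; move: aR bR; lra.
Qed.

Let L_ge : 1 / 2 <= L.
Proof.
have nR : 2 <= n%:R :> R by rewrite ler_nat.
(* [1 - ln n <= exp (- ln n) = 1 / n]. *)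
have := expR_ge1Dx (- L); rewrite expRN /L lnK ?posrE; last by lra.
have : n%:R^-1 <= 2^-1 :> R by rewrite lef_pV2 ?posrE //; lra.
lra.
Qed.

Let le_aL : 2 * a%:R * L <= n%:R.
Proof.
move: le_an; rewrite ler_pdivlMr; last by move: L_ge; lra.
by rewrite mulrCA mulrA.
Qed.

Let nR_ge : 4 <= n%:R :> R. Proof. by move: le_aL aR bR L_ge; nra. Qed.
Let n_posR : 0 < n%:R :> R. Proof. by move: nR_ge; lra. Qed.
Let NE : N%:R = 4 * n%:R :> R. Proof. by rewrite /N natrM. Qed.
Let L_gt0 : 0 < L. Proof. by move: L_ge; lra. Qed.
Let b_gt0 : 0 < b%:R :> R. Proof. by move: bR; lra. Qed.
Let a_gt0 : 0 < a%:R :> R. Proof. by move: aR bR; lra. Qed.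

Let K_lb : 4 * b%:R * L <= K%:R.
Proof. by rewrite ltW // truncnS_gt. Qed.

Let K_ub : K%:R <= 4 * b%:R * L + 1.
Proof.
have -> : K%:R = (Num.truncn (4 * b%:R * L))%:R + 1 :> R by rewrite natr1.
by rewrite lerD2r truncn_le !mulr_ge0 // ltW.
Qed.

Lemma threshold_le : (K <= N)%N.
Proof.
rewrite -(ler_nat R) NE; apply: le_trans K_ub _.
move: le_aL aR L_ge nR_ge; nra.
Qed.

Let gap_ge : 7 / 4 <= a%:R - b%:R - a%:R / N%:R :> R.
Proof.
have le_an1 : a%:R <= n%:R :> R by move: le_aL L_ge a_gt0; nra.
have : a%:R / N%:R <= 1 / 4 :> R.
  by rewrite NE ler_pdivrMr ?mulr_gt0 //; lra.
move: aR; lra.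
Qed.

Lemma gap_gt0 : 0 < a%:R - b%:R - a%:R / N%:R :> R.
Proof. by move: gap_ge; lra. Qed.

Let e := m * (b%:R / a%:R) ^+ n.-1.
Let e_ge0 : 0 <= e.
Proof. by rewrite mulr_ge0 ?exprn_ge0 ?divr_ge0. Qed.

(** Writing [e = m (b / a) ^ (n - 1)], the left-hand side is at most
    [e b / n], whose square is at most [1 / (a b n ln n) <= 1 / 16]. *)
Lemma static_weight_le : m * a%:R * ((b%:R - K%:R / N%:R) / a%:R) ^+ n <= 1 / 4.
Proof.
pose q : R := K%:R / N%:R / b%:R.
have q_lb : L <= n%:R * q.
  have -> : n%:R * q = K%:R / (4 * b%:R) by rewrite /q NE; field; rewrite !gt_eqF.
  by rewrite ler_pdivlMr ?mulr_gt0 //; move: K_lb; lra.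
have q_le1 : q <= 1.
  rewrite /q NE ler_pdivrMr // mul1r ler_pdivrMr ?mulr_gt0 //.
  have := threshold_le; rewrite -(ler_nat R) NE; move: bR n_posR; nra.
have -> : m * a%:R * ((b%:R - K%:R / N%:R) / a%:R) ^+ n = e * b%:R * (1 - q) ^+ n.
  have -> : (b%:R - K%:R / N%:R) / a%:R = b%:R / a%:R * (1 - q).
    by rewrite /q; field; rewrite !gt_eqF // NE mulr_gt0.
  rewrite exprMn -[in (b%:R / a%:R) ^+ n](prednK n_gt0) exprS /e.
  by field; rewrite gt_eqF.
have : (1 - q) ^+ n <= n%:R^-1.
  rewrite -[n%:R]lnK ?posrE // -expRN.
  apply: le_trans (exp1D_le _ _) _; first by lra.
  by rewrite ler_expR mulrN lerN2.
move=> small; apply: (@le_trans _ _ (e * b%:R / n%:R)).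
  by rewrite ler_wpM2l // mulr_ge0 // ltW.
have ebn_ge0 : 0 <= e * b%:R / n%:R by rewrite divr_ge0 // mulr_ge0.
have quarter_ge0 : 0 <= 1 / 4 :> R by lra.
rewrite -(ler_pXn2r (n := 2)) ?nnegrE //.
have -> : (e * b%:R / n%:R) ^+ 2 = e ^+ 2 * (b%:R ^+ 2 / n%:R ^+ 2).
  by field; rewrite gt_eqF.
apply: le_trans (ler_wpM2r _ le_m) _; first by rewrite divr_ge0 ?sqr_ge0.
have -> : n%:R / (a%:R * b%:R ^+ 3 * L) * (b%:R ^+ 2 / n%:R ^+ 2)
   = (a%:R * b%:R * L * n%:R)^-1 by field; rewrite !gt_eqF.
have -> : (1 / 4) ^+ 2 = 16^-1 :> R by field.
rewrite lef_pV2 ?posrE ?(mulr_gt0 (mulr_gt0 (mulr_gt0 a_gt0 b_gt0) L_gt0)) //.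
have aL : 2 <= a%:R * L by move: aR bR L_ge; nra.
have abL : 4 <= a%:R * L * b%:R by move: bR; nra.
rewrite mulrAC; move: nR_ge; nra.
Qed.

(** The bound on [e ^ 2] times [K / N], which is about [b ln n / n], is about
    [1 / (a b ^ 2)], and the last factor is about [a b / (a - b)].  The product
    is about [1 / (b (a - b)) <= 1 / 4], which leaves a factor [2] for the
    rounding errors. *)
Lemma swap_weight_le :
  m ^+ 2 * (K%:R / N%:R) * edge_pair_weight R a b N ^+ n.-1
    * (b%:R * (a%:R - 1) / (a%:R - b%:R - a%:R / N%:R)) <= 1 / 2.
Proof.
have N_gt0 : 0 < N%:R :> R by rewrite NE mulr_gt0.
pose D := (1 + (b%:R * N%:R)^-1) ^+ n.-1 : R.
have D_le : D <= 8 / 7.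
  have bN_gt0 : 0 < b%:R * N%:R :> R by rewrite mulr_gt0.
  apply: le_trans (exp1D_le _ _) _.
    by rewrite addr_ge0 // invr_ge0 ltW.
  apply: (@le_trans _ _ (expR (1 / 8))).
    rewrite ler_expR ler_pdivrMr // NE.
    have : n.-1%:R <= n%:R :> R by rewrite ler_nat leq_pred.
    move: bR n_posR; nra.
  have := expR_ge1Dx (- (1 / 8) : R); rewrite expRN.
  have -> : 8 / 7 = (7 / 8)^-1 :> R by field.
  move=> ?; rewrite -[leLHS]invrK lef_pV2 ?posrE ?invr_gt0 ?expR_gt0 //; lra.
have D_ge0 : 0 <= D by rewrite exprn_ge0 // addr_ge0 // invr_ge0 mulr_ge0.
rewrite /edge_pair_weight exprMn -/D -exprM [(2 * _)%N]mulnC exprM.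
have -> : m ^+ 2 * (K%:R / N%:R) * (((b%:R / a%:R) ^+ n.-1) ^+ 2 * D)
  = e ^+ 2 * (K%:R / N%:R) * D by rewrite /e; ring.
have eK : e ^+ 2 * (K%:R / N%:R) <= 5 / 4 / (a%:R * b%:R ^+ 2).
  apply: le_trans (ler_wpM2r _ le_m) _; first by rewrite divr_ge0.
  have -> : n%:R / (a%:R * b%:R ^+ 3 * L) * (K%:R / N%:R)
     = K%:R / (4 * b%:R * L) / (a%:R * b%:R ^+ 2).
    by rewrite NE; field; rewrite !gt_eqF.
  rewrite ler_wpM2r ?invr_ge0 ?mulr_ge0 ?sqr_ge0 //.
  rewrite ler_pdivrMr ?mulr_gt0 //; apply: le_trans K_ub _.
  move: bR L_ge; nra.
have eK_ge0 : 0 <= e ^+ 2 * (K%:R / N%:R) by rewrite mulr_ge0 ?sqr_ge0 ?divr_ge0.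
have gap_le : b%:R * (a%:R - 1) / (a%:R - b%:R - a%:R / N%:R)
    <= b%:R * a%:R * (4 / 7) :> R.
  rewrite ler_pdivrMr ?gap_gt0 //.
  have ba_gt0 : 0 < b%:R * a%:R :> R by rewrite mulr_gt0.
  move: gap_ge b_gt0; nra.
have gap_ge0 : 0 <= b%:R * (a%:R - 1) / (a%:R - b%:R - a%:R / N%:R) :> R.
  rewrite divr_ge0 ?(ltW gap_gt0) // mulr_ge0 //; move: aR bR; lra.
apply: (@le_trans _ _ (5 / 4 / (a%:R * b%:R ^+ 2) * (8 / 7) * (b%:R * a%:R * (4 / 7)))).
  by apply: ler_pM => //; [exact: mulr_ge0 | exact: ler_pM].
have -> : 5 / 4 / (a%:R * b%:R ^+ 2) * (8 / 7) * (b%:R * a%:R * (4 / 7))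
  = (40 / 49) / b%:R :> R by field; rewrite !gt_eqF.
by rewrite ler_pdivrMr //; move: bR; lra.
Qed.

End Numerics.

Lemma sqr_powR_half (R : realType) (x : R) : 0 <= x -> (x `^ (1 / 2)) ^+ 2 = x.
Proof. by move=> x_ge0; rewrite div1r powR12_sqrt // sqr_sqrtr. Qed.

Lemma sqr_edge_weight_le (R : realType) (a b n : nat) (m : R) :
  (0 < a)%N -> (0 < b)%N -> (0 < n)%N -> 0 <= m ->
  m <= (a%:R * b%:R ^+ 3) `^ (- (1 / 2)) * (n%:R / ln n%:R) `^ (1 / 2)
       * (a%:R / b%:R) ^+ n.-1 ->
  (m * (b%:R / a%:R) ^+ n.-1) ^+ 2 <= n%:R / (a%:R * b%:R ^+ 3 * ln n%:R).
Proof.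
move=> a_gt0 b_gt0 n_gt0 m_ge0 le_m.
have aR : 0 < a%:R :> R by rewrite ltr0n.
have bR : 0 < b%:R :> R by rewrite ltr0n.
have L_ge0 : 0 <= ln n%:R :> R by rewrite ln_ge0 // ler1n.
pose s : R := (a%:R * b%:R ^+ 3) `^ (- (1 / 2)) * (n%:R / ln n%:R) `^ (1 / 2).
have s_ge0 : 0 <= s by rewrite mulr_ge0 ?powR_ge0.
have ba_ge0 : 0 <= (b%:R / a%:R) ^+ n.-1 :> R by rewrite exprn_ge0 ?divr_ge0.
have le_s : m * (b%:R / a%:R) ^+ n.-1 <= s.
  apply: le_trans (ler_wpM2r ba_ge0 le_m) _.
  rewrite -[leLHS]mulrA -[_ ^+ _ * _ ^+ _]exprMn.
  have -> : a%:R / b%:R * (b%:R / a%:R) = 1 :> R by field; rewrite !gt_eqF.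
  by rewrite expr1n mulr1.
have -> : n%:R / (a%:R * b%:R ^+ 3 * ln n%:R) = s ^+ 2.
  rewrite exprMn powRN exprVn !sqr_powR_half ?divr_ge0 ?mulr_ge0 ?exprn_ge0 //.
  by rewrite invfM mulrCA.
by rewrite lerXn2r ?nnegrE // mulr_ge0.
Qed.

(** * Conclusion *)

(** Vertices outside all edges may receive any [b] colors, so that it suffices
    to color the finite union of the edges. *)
Lemma colorable_of_fsub (V : choiceType) (a b : nat) (H : hypergraph V)
    (U := (\bigcup_(A <- H) A)%fset) (chi : U -> {set 'I_a}) :
  (b <= a)%N -> (forall v, #|chi v| = b) ->
  (forall A d, A \in H -> exists2 u, u \in fsub U A & d \notin chi u) ->
  colorable a b H.
Proof.
move=> le_ba card_chi proper.
exists (fun v => odflt [set i : 'I_a | (i < b)%N] (omap chi (insub v))).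
split=> [v|A AH].
  by case: insubP => [u _ _|_] /=; [exact: card_chi | exact: card_ord_lt].
apply/setP => d; rewrite in_set0; apply/negP => dA.
have [u] := proper A d AH; rewrite in_fsub => uA /negP[].
by move: dA; rewrite (big_rem _ uA) /= valK inE => /andP[].
Qed.

Theorem theorem1 (R : realType) (a b n : nat)
    (ha : (0 < a)%N) (hb : (0 < b)%N) (hn : (0 < n)%N)
    (hb2 : (2 <= b)%N) (hba : (b%:Z <= a%:Z - 2)%R)
    (han : a%:R <= n%:R / (2 * ln n%:R) :> R)
    (V : choiceType) (H : hypergraph V) (hH : uniform n H)
    (hE : (#|` H|)%:R <=
          (a%:R * b%:R ^+ 3) `^ (- (1 / 2)) * (n%:R / ln n%:R) `^ (1 / 2)
          * (a%:R / b%:R) ^+ (n - 1) :> R) :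
  colorable a b H.
Proof.
have le_b2a : (b + 2 <= a)%N by lia.
have lt_ba : (b < a)%N by lia.
pose U := (\bigcup_(A <- H) A)%fset.
pose E := [set fsub U (val A) | A : H].
have subU (A : {fset V}) : A \in H -> (A `<=` U)%fset.
  by move=> AH; apply: (bigfcup_sup id).
have le_EH : #|E|%:R <= (#|` H|)%:R :> R by rewrite ler_nat cardfE leq_imset_card.
rewrite subn1 in hE.
have le_m := sqr_edge_weight_le ha hb hn (ler0n R _) (le_trans le_EH hE).
have N_gt0 : (0 < 4 * n)%N by lia.
have unifE (A : {set U}) : A \in E -> #|A| = n.
  by case/imsetP => B _ ->; rewrite card_fsub ?subU ?hH ?fsvalP.
have le_KN := threshold_le hb2 le_b2a hn han.
have gap := gap_gt0 hb2 le_b2a hn han.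
have static_le := static_weight_le hb2 le_b2a hn han (ler0n R _) le_m.
have swap_le := swap_weight_le hb2 le_b2a hn han le_m.
have lt1 := le_lt_trans (lerD static_le swap_le) (ltac:(lra) : 1 / 4 + 1 / 2 < 1).
have [chi [card_chi proper]] :=
  colorable_of_weight hb lt_ba N_gt0 unifE le_KN gap lt1.
apply: (colorable_of_fsub (ltnW lt_ba) card_chi) => A d AH.
by apply: proper; apply/imsetP; exists [` AH]%fset.
Qed.
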